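(* Let $\alpha=\frac{2\pi}{3}$ and let $\alpha,\beta,\gamma$ be distinct. The spherical tilings by $12$ angle congruent pentagons with angles $\alpha,\alpha,\beta,\beta,\gamma$ are, up to symmetry, given by the following tilings (angle words on the dodecahedral pattern, as explained in the context). Tiling I: $P_1:\gamma\alpha\beta\beta\alpha$; $P_2:\alpha\gamma\alpha\beta\beta$; $P_3:\beta\beta\alpha\gamma\alpha$; $P_4:\alpha\beta\beta\alpha\gamma$; $P_5:\beta\alpha\gamma\alpha\beta$; $P_6:\gamma\alpha\beta\beta\alpha$; $P_7:\beta\alpha\gamma\alpha\beta$; $P_8:\alpha\beta\beta\alpha\gamma$; $P_9:\beta\beta\alpha\gamma\alpha$; $P_{10}:\alpha\gamma\alpha\beta\beta$; $P_{11}:\gamma\alpha\beta\beta\alpha$; $P_{12}:\beta\alpha\gamma\alpha\beta$. Tiling II: $P_1:\beta\alpha\beta\gamma\alpha$; $P_2:\alpha\beta\alpha\beta\gamma$; $P_3:\beta\gamma\alpha\beta\alpha$; $P_4:\alpha\beta\gamma\alpha\beta$; $P_5:\gamma\alpha\beta\alpha\beta$; $P_6:\beta\alpha\beta\gamma\alpha$; $P_7:\gamma\alpha\beta\alpha\beta$; $P_8:\alpha\beta\gamma\alpha\beta$; $P_9:\beta\gamma\alpha\beta\alpha$; $P_{10}:\alpha\beta\alpha\beta\gamma$; $P_{11}:\beta\alpha\beta\gamma\alpha$; $P_{12}:\gamma\alpha\beta\alpha\beta$; where, around any of the six edges $E_{1,5},E_{2,3},E_{4,8},E_{6,11},E_{7,12},E_{9,10}$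 (independently), one can exchange the four angles $\beta$ and $\gamma$ around that edge and still get a tiling; the tilings so obtained are included.
   Context: A spherical tiling by $12$ pentagons (graph embedded in $S^2$ with all vertices of degree $\ge 3$, every tile a five-edged region enclosed by a simple closed curve; edges may be any nice curves) is combinatorially the dodecahedral pattern: tiles $P_1,\dots,P_{12}$, where $P_i$ with list $(n_1,\dots,n_5)$ has edges in counterclockwise order $E_{i,n_1},\dots,E_{i,n_5}$, $E_{i,j}=E_{j,i}$ being the common edge of $P_i$ and $P_j$, and (with $n_6=n_1$) $E_{i,n_k},E_{i,n_{k+1}}$ meet at the vertex $V_{i,n_k,n_{k+1}}$ of degree $3$ shared by $P_i,P_{n_k},P_{n_{k+1}}$: $P_1:(2,3,4,5,6)$; $P_2:(1,6,11,7,3)$; $P_3:(1,2,7,8,4)$; $P_4:(1,3,8,9,5)$; $P_5:(1,4,9,10,6)$; $P_6:(1,5,10,11,2)$; $P_7:(12,8,3,2,11)$; $P_8:(12,9,4,3,7)$; $P_9:(12,10,5,4,8)$; $P_{10}:(12,11,6,5,9)$; $P_{11}:(12,7,2,6,10)$; $P_{12}:(7,11,10,9,8)$. ''$P_i:w_1w_2w_3w_4w_5$'' means that the angle of $P_i$ at $V_{i,n_k,n_{k+1}}$ is $w_k$ for $k=1,\dots,5$. An angle congruent tiling is considered as an assignment of angles to all (tile, vertex) corners such that the angles at every vertex sum to $2\pi$ and any two tiles are angle congruent, i.e. there is an adjacency-preserving correspondence of their edges that preserves the angles between adjacent edges (reflections allowed). No geometric realization by great arcs is required. The four angles around an edge $E_{i,j}$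 are the angles of $P_i$ and of $P_j$ at the two end vertices of $E_{i,j}$; exchanging $\beta$ and $\gamma$ around it means replacing $\beta$ by $\gamma$ and $\gamma$ by $\beta$ in these four corners. ''Up to symmetry'' means up to symmetries of the dodecahedral pattern (including reflections). *)

(* Defs.v *)
From HB Require Import structures.
From mathcomp Require Import all_boot all_order all_algebra all_fingroup.
From mathcomp Require Import reals trigo.

Set Implicit Arguments.
Unset Strict Implicit.
Unset Printing Implicit Defensive.

Import Order.TTheory GRing.Theory Num.Theory.

(* The tile P_i, 1 <= i <= 12, is the element of value i - 1 of 'I_12. *)
Notation tile := 'I_12.

Definition Ptile (i : nat) : tile := inZp i.-1.

(* Row i lists, counterclockwise, the neighbours n_1, ..., n_5 of P_i. *)
Definition neighbour_table : seq (seq nat) :=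
  [:: [:: 2; 3; 4; 5; 6];
      [:: 1; 6; 11; 7; 3];
      [:: 1; 2; 7; 8; 4];
      [:: 1; 3; 8; 9; 5];
      [:: 1; 4; 9; 10; 6];
      [:: 1; 5; 10; 11; 2];
      [:: 12; 8; 3; 2; 11];
      [:: 12; 9; 4; 3; 7];
      [:: 12; 10; 5; 4; 8];
      [:: 12; 11; 6; 5; 9];
      [:: 12; 7; 2; 6; 10];
      [:: 7; 11; 10; 9; 8]].

(* An element k of 'I_5 also names the edge of P_i shared with its neighbour
   number k; cyclically consecutive edges (k and ordS k) are the adjacent ones. *)
Definition neighbour (i : tile) (k : 'I_5) : tile :=
  Ptile (nth 0 (nth [::] neighbour_table i) k).

(* The corner (i, k) is the corner of P_i between its edges k and ordS k, that
   is, at the vertex V_{i, n_k, n_(k+1)}. *)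
Notation corner := (tile * 'I_5)%type.

(* In the dodecahedral pattern an edge is determined by the two tiles that
   share it and a vertex by the three tiles that meet there. *)
Definition edge (i : tile) (k : 'I_5) : {set tile} := [set i; neighbour i k].

Definition vertex (c : corner) : {set tile} :=
  [set c.1; neighbour c.1 c.2; neighbour c.1 (ordS c.2)].

Definition is_edge (e : {set tile}) : bool :=
  [exists i, exists k, e == edge i k].

Definition is_vertex (v : {set tile}) : bool := [exists c, v == vertex c].

(* Symmetries, orientation-reversing ones included. *)
Definition pattern_symmetry (s : {perm tile}) : Prop :=
  (forall e : {set tile}, is_edge (s @: e) = is_edge e) /\
  (forall v : {set tile}, is_vertex (s @: v) = is_vertex v).

(* For a pattern symmetry s, exactly one corner d is the image of c. *)
Definition carries (T : Type) (s : {perm tile}) (a b : corner -> T) : Prop :=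
  forall c d : corner, d.1 = s c.1 -> vertex d = s @: vertex c -> b d = a c.

Definition same_up_to_symmetry (T : Type) (a b : corner -> T) : Prop :=
  exists2 s : {perm tile}, pattern_symmetry s & carries s a b.

Section Tilings.
Local Open Scope ring_scope.
Variable R : realType.
Implicit Type a : corner -> R.

Definition vertex_sums a : Prop :=
  forall v : {set tile}, is_vertex v -> \sum_(c | vertex c == v) a c = 2 * pi.

(* f is the correspondence of edges; the edges l and ordS l are those meeting at
   the corner (j, l). *)
Definition angle_congruent a (i j : tile) : Prop :=
  exists f : {perm 'I_5}, forall k : 'I_5,
    exists2 l : 'I_5, [set f k; f (ordS k)] = [set l; ordS l]
                    & a (j, l) = a (i, k).

Definition angle_congruent_tiling a : Prop :=
  vertex_sums a /\ (forall i j : tile, angle_congruent a i j).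

Definition tile_angles a (i : tile) : seq R := [seq a (i, k) | k <- enum 'I_5].

Definition tiling_with_angles (w : seq R) a : Prop :=
  angle_congruent_tiling a /\ (forall i : tile, perm_eq (tile_angles a i) w).

End Tilings.

Inductive letter := Alpha | Beta | Gamma.

Definition letter_value (T : Type) (alpha beta gamma : T) (x : letter) : T :=
  match x with Alpha => alpha | Beta => beta | Gamma => gamma end.

Definition swap_beta_gamma (x : letter) : letter :=
  match x with Alpha => Alpha | Beta => Gamma | Gamma => Beta end.

Definition of_table (t : seq (seq letter)) (c : corner) : letter :=
  nth Alpha (nth [::] t c.1) c.2.

Definition tilingI : corner -> letter :=
  let a := Alpha in let b := Beta in let g := Gamma in
  of_table
  [:: [:: g; a; b; b; a];
      [:: a; g; a; b; b];
      [:: b; b; a; g; a];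
      [:: a; b; b; a; g];
      [:: b; a; g; a; b];
      [:: g; a; b; b; a];
      [:: b; a; g; a; b];
      [:: a; b; b; a; g];
      [:: b; b; a; g; a];
      [:: a; g; a; b; b];
      [:: g; a; b; b; a];
      [:: b; a; g; a; b]].

Definition tilingII : corner -> letter :=
  let a := Alpha in let b := Beta in let g := Gamma in
  of_table
  [:: [:: b; a; b; g; a];
      [:: a; b; a; b; g];
      [:: b; g; a; b; a];
      [:: a; b; g; a; b];
      [:: g; a; b; a; b];
      [:: b; a; b; g; a];
      [:: g; a; b; a; b];
      [:: a; b; g; a; b];
      [:: b; g; a; b; a];
      [:: a; b; a; b; g];
      [:: b; a; b; g; a];
      [:: g; a; b; a; b]].

(* c is one of the four corners around e: it belongs to one of the two tiles of
   e, and its vertex is an end of e. *)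
Definition around (e : {set tile}) (c : corner) : bool :=
  (c.1 \in e) && (e \subset vertex c).

Definition exchangeable_edges : {set {set tile}} :=
  [set [set Ptile 1; Ptile 5]; [set Ptile 2; Ptile 3]; [set Ptile 4; Ptile 8];
       [set Ptile 6; Ptile 11]; [set Ptile 7; Ptile 12]; [set Ptile 9; Ptile 10]].

(* The six exchangeable edges have no tile in common, so the exchanges around
   them concern disjoint sets of corners and can be made simultaneously. *)
Definition exchange (S : {set {set tile}}) (t : corner -> letter) (c : corner) :
    letter :=
  if [exists e in S, around e c] then swap_beta_gamma (t c) else t c.

Definition listed (t : corner -> letter) : Prop :=
  t = tilingI \/
  exists2 S : {set {set tile}}, S \subset exchangeable_edges
                              & t = exchange S tilingII.

(* Main.v *)
Require Import Defs.
From HB Require Import structures.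
From mathcomp Require Import all_boot all_order all_algebra all_fingroup.
From mathcomp Require Import reals trigo.
From mathcomp Require boolp.
From mathcomp Require Import lra.

Set Implicit Arguments.
Unset Strict Implicit.
Unset Printing Implicit Defensive.

Import Order.TTheory GRing.Theory Num.Theory.
Local Open Scope ring_scope.

(** Summing the angle sums over all vertices gives 2 beta + gamma = 2 pi, and as
    3 alpha = 2 pi too, the only possible vertices are alpha^3 and beta^2 gamma.
    Angle congruence of two tiles means that their cyclic words differ by a
    rotation or a reflection.  The problem is thus finite: placing the tiles one
    by one, with one of the four cyclic words on alpha^2 beta^2 gamma, leaves
    320 + 5 labelled patterns, each of which is a rotation about P_1 of a listed
    one. *)

(** * The dodecahedral pattern on natural numbers *)

Section NatPattern.
Local Open Scope nat_scope.

(** Natural numbers replace ordinals so that facts about the pattern can be checked by evaluation;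
    the predecessor makes the numbering of tiles start at 0. *)
Definition nbr (i k : nat) : nat := (nth 0 (nth [::] neighbour_table i) k).-1.

Definition edge_tiles (c : nat * nat) : seq nat := [:: c.1; nbr c.1 c.2].

Definition vertex_tiles (c : nat * nat) : seq nat :=
  [:: c.1; nbr c.1 c.2; nbr c.1 (c.2.+1 %% 5)].

Definition same_elements (s1 s2 : seq nat) : bool :=
  all (mem s2) s1 && all (mem s1) s2.

Definition nat_corners : seq (nat * nat) :=
  [seq (i, k) | i <- iota 0 12, k <- iota 0 5].

(* Tiles and their edges are both listed counterclockwise, so at the tile
   across edge [k] the corner with the same vertex comes just before the edge
   leading back. *)
Definition next_nat (c : nat * nat) : nat * nat :=
  let j := nbr c.1 c.2 in
  (j, (index c.1 [seq nbr j k | k <- iota 0 5] + 4) %% 5).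

End NatPattern.

Definition nat_corner (c : corner) : nat * nat := (val c.1, val c.2).

Definition next_corner (c : corner) : corner :=
  (neighbour c.1 c.2, inord (next_nat (nat_corner c)).2).

Definition tiles_of (s : seq nat) : {set tile} := [set x | val x \in s].

Lemma mem_nat_corners (c : corner) : nat_corner c \in nat_corners.
Proof. by apply: allpairs_f; rewrite mem_iota /= ltn_ord. Qed.

Lemma nat_corner_inj : injective nat_corner.
Proof. by move=> [i k] [j l] [/val_inj -> /val_inj ->]. Qed.

Lemma all_nat_corners (P : pred (nat * nat)) (c : corner) :
  all P nat_corners -> P (nat_corner c).
Proof. by move=> /allP; apply; exact: mem_nat_corners. Qed.

Lemma all_tiles (P : pred nat) (i : tile) : all P (iota 0 12) -> P i.
Proof. by move=> /allP; apply; rewrite mem_iota /= ltn_ord. Qed.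

Lemma nbr_lt (i : tile) (k : 'I_5) : (nbr i k < 12)%N.
Proof.
apply: (@all_nat_corners (fun c => nbr c.1 c.2 < 12)%N (i, k)).
by vm_compute.
Qed.

Lemma val_neighbour (i : tile) (k : 'I_5) : val (neighbour i k) = nbr i k.
Proof. by rewrite /= modn_small // nbr_lt. Qed.

Lemma edgeE (i : tile) (k : 'I_5) :
  edge i k = tiles_of (edge_tiles (nat_corner (i, k))).
Proof. by apply/setP => x; rewrite !inE -!val_eqE val_neighbour. Qed.

Lemma vertexE (c : corner) : vertex c = tiles_of (vertex_tiles (nat_corner c)).
Proof. by apply/setP => x; rewrite !inE -!val_eqE !val_neighbour orbA. Qed.

(** The bound matters because [tiles_of] drops numbers that name no tile. *)
Lemma tiles_of_sub (s1 s2 : seq nat) :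
  all (gtn 12) s1 -> (tiles_of s1 \subset tiles_of s2) = all (mem s2) s1.
Proof.
move=> /allP lt12; apply/subsetP/allP => [sub x xs | sub x]; last first.
  by rewrite !inE => /sub.
by have := sub (Ordinal (lt12 x xs)); rewrite !inE; apply.
Qed.

Lemma tiles_of_eq (s1 s2 : seq nat) :
  all (gtn 12) s1 -> all (gtn 12) s2 ->
  (tiles_of s1 == tiles_of s2) = same_elements s1 s2.
Proof. by move=> h1 h2; rewrite eqEsubset !tiles_of_sub. Qed.

Lemma vertex_tiles_lt (c : corner) : all (gtn 12) (vertex_tiles (nat_corner c)).
Proof.
by apply: (@all_nat_corners (fun c => all (gtn 12) (vertex_tiles c))); vm_compute.
Qed.

Lemma edge_tiles_lt (c : corner) : all (gtn 12) (edge_tiles (nat_corner c)).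
Proof.
by apply: (@all_nat_corners (fun c => all (gtn 12) (edge_tiles c))); vm_compute.
Qed.

Lemma neighbour_neq (i : tile) (k : 'I_5) : neighbour i k != i.
Proof.
rewrite -val_eqE val_neighbour.
apply: (@all_nat_corners (fun c => nbr c.1 c.2 != c.1) (i, k)).
by vm_compute.
Qed.

Lemma neighbour_inj (i : tile) : injective (neighbour i).
Proof.
move=> k l /(congr1 val); rewrite !val_neighbour => /eqP e; apply/val_inj/eqP.
apply: implyP e.
have := @all_nat_corners (fun c => all (fun l =>
  (nbr c.1 c.2 == nbr c.1 l) ==> (c.2 == l)) (iota 0 5)) (i, k).
by move=> /(_ _)/allP; apply; rewrite ?mem_iota ?ltn_ord //; vm_compute.
Qed.

Lemma neighbour_sym (i : tile) (k : 'I_5) :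
  exists l, neighbour (neighbour i k) l = i.
Proof.
have : has (fun l => nbr (nbr i k) l == i) (iota 0 5).
  apply: (@all_nat_corners
    (fun c => has (fun l => nbr (nbr c.1 c.2) l == c.1) (iota 0 5)) (i, k)).
  by vm_compute.
case/hasP => l; rewrite mem_iota => /= l5 /eqP e; exists (Ordinal l5).
by apply: val_inj; rewrite !val_neighbour.
Qed.

(** * Turning around a vertex of degree 3 *)

Lemma nat_corner_next (c : corner) :
  nat_corner (next_corner c) = next_nat (nat_corner c).
Proof.
rewrite /nat_corner /= inordK; last by rewrite ltn_mod.
by rewrite modn_small ?nbr_lt.
Qed.

Lemma next_corner3 (c : corner) : next_corner (next_corner (next_corner c)) = c.
Proof.
apply: nat_corner_inj; rewrite !nat_corner_next; apply/eqP.
by apply: (@all_nat_corners (fun c => next_nat (next_nat (next_nat c)) == c));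
  vm_compute.
Qed.

Lemma next_corner_inj : injective next_corner.
Proof. by move=> c d e; rewrite -(next_corner3 c) e next_corner3. Qed.

(** The fibres of [vertex] are the orbits of [next_corner]; this turns each vertex sum into three
    explicit terms. *)
Lemma vertex_eqE (c d : corner) :
  (vertex d == vertex c) = (d \in [:: c; next_corner c; next_corner (next_corner c)]).
Proof.
rewrite !vertexE tiles_of_eq ?vertex_tiles_lt //.
rewrite -(mem_map nat_corner_inj) /= !nat_corner_next.
have := @all_nat_corners (fun c => all (fun d =>
  same_elements (vertex_tiles d) (vertex_tiles c) ==
  (d \in [:: c; next_nat c; next_nat (next_nat c)])) nat_corners) c.
move=> /(_ _)/allP H; apply/eqP/H; last exact: mem_nat_corners.
by vm_compute.
Qed.

Lemma uniq_next (c : corner) :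
  uniq [:: c; next_corner c; next_corner (next_corner c)].
Proof.
rewrite -(map_inj_uniq nat_corner_inj) /= !nat_corner_next.
by apply: (@all_nat_corners
  (fun c => uniq [:: c; next_nat c; next_nat (next_nat c)])); vm_compute.
Qed.

Lemma vertex_next (c : corner) : vertex (next_corner c) = vertex c.
Proof. by apply/eqP; rewrite vertex_eqE !inE eqxx orbT. Qed.

Lemma next_next_tile (c : corner) :
  (next_corner (next_corner c)).1 = neighbour c.1 (ordS c.2).
Proof.
apply: val_inj; rewrite val_neighbour.
rewrite -[LHS]/(nat_corner (next_corner (next_corner c))).1 !nat_corner_next.
apply/eqP.
by apply: (@all_nat_corners (fun c =>
  (next_nat (next_nat c)).1 == nbr c.1 (c.2.+1 %% 5)%N)); vm_compute.
Qed.

Lemma mem_vertex (i : tile) (c : corner) :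
  i \in vertex c -> exists2 d : corner, d.1 = i & vertex d = vertex c.
Proof.
rewrite !inE -orbA => /or3P [] /eqP ->; first by exists c.
- by exists (next_corner c) => //; rewrite vertex_next.
- by exists (next_corner (next_corner c)); rewrite ?next_next_tile ?vertex_next.
Qed.

Lemma corner_inj (c d : corner) : c.1 = d.1 -> vertex c = vertex d -> c = d.
Proof.
case: c d => [i k] [j l] /= -> /eqP.
rewrite !vertexE tiles_of_eq ?vertex_tiles_lt // => h.
apply/nat_corner_inj/eqP; move: h.
have := @all_nat_corners (fun d => all (fun k =>
  same_elements (vertex_tiles (d.1, k)) (vertex_tiles d) ==> ((d.1, k) == d))
  (iota 0 5)) (j, l).
move=> /(_ _)/allP H; apply/implyP/H; last by rewrite mem_iota /= ltn_ord.
by vm_compute.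
Qed.

Lemma vertex_sumE (R : realType) (a : corner -> R) (c : corner) :
  \sum_(d | vertex d == vertex c) a d =
    a c + a (next_corner c) + a (next_corner (next_corner c)).
Proof.
rewrite (eq_bigl (mem [:: c; next_corner c; next_corner (next_corner c)])) => [|d]; last first.
  exact: vertex_eqE.
by rewrite -big_uniq ?uniq_next //= !big_cons big_nil addr0 addrA.
Qed.

Lemma vertex_sumsP (R : realType) (a : corner -> R) :
  vertex_sums a <->
  forall c, a c + a (next_corner c) + a (next_corner (next_corner c)) = 2 * pi.
Proof.
split=> [h c | h v /existsP [c /eqP ->]]; last by rewrite vertex_sumE.
by rewrite -vertex_sumE h //; apply/existsP; exists c.
Qed.

(** * Congruence of tiles *)

(* [angle_congruent a i j] is [congruent a a i j]; two assignments are needed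
   to compare a tile with its image under a symmetry. *)
Definition congruent (T : Type) (a b : corner -> T) (i j : tile) : Prop :=
  exists f : {perm 'I_5}, forall k : 'I_5,
    exists2 l : 'I_5, [set f k; f (ordS k)] = [set l; ordS l]
                    & b (j, l) = a (i, k).

Lemma congruent_trans (T : Type) (a b c : corner -> T) (i j k : tile) :
  congruent a b i j -> congruent b c j k -> congruent a c i k.
Proof.
move=> [f hf] [g hg]; exists (f * g)%g => x.
have [y fxy bx] := hf x; have [z gyz cy] := hg y; exists z; last by rewrite cy.
have := congr1 (fun A : {set 'I_5} => g @: A) fxy; rewrite !imsetU !imset_set1 gyz.
by rewrite !permM.
Qed.

Lemma ordS5E (k : 'I_5) : ordS k = k + 1.
Proof. by apply: val_inj; rewrite /= addn1. Qed.

Lemma edge_pair_cases (x y l : 'I_5) : x != y ->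
  [set x; y] = [set l; ordS l] -> (x = l /\ y = l + 1) \/ (y = l /\ x = l + 1).
Proof.
rewrite ordS5E => xy e.
have : x \in [set l; l + 1] by rewrite -e set21.
have : y \in [set l; l + 1] by rewrite -e set22.
rewrite !inE => /orP[]/eqP yE /orP[]/eqP xE; move: xy; rewrite xE yE ?eqxx // => _.
  by right.
by left.
Qed.

(** A permutation of the five edges that keeps adjacency moves by 1 or -1 modulo 5 at each step;
    injectivity forbids a change of direction, so it is a rotation or a reflection of the
    5-cycle. *)
Lemma congruentP (T : Type) (a b : corner -> T) (i j : tile) :
  congruent a b i j <->
  exists r e : 'I_5, (e = 1 \/ e = -1) /\ forall k, b (j, r + e * k) = a (i, k).
Proof.
split=> [[f hf] | [r [e [he hb]]]]; last first.
  (* The corner [k] lies between the edges [k] and [k + 1]. A reflection swaps their order, so its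
     edge map starts at [r + 1] when its corner map starts at [r]. *)
  have f_inj : injective (fun k => (if e == 1 then r else r + 1) + e * k).
    move=> k l /addrI; case: he => ->; rewrite ?mul1r //.
    by rewrite !mulN1r => /oppr_inj.
  exists (perm f_inj) => k; exists (r + e * k); rewrite // !permE !ordS5E.
  case: he => -> /=; first by rewrite mulrDr mulr1 addrA.
  rewrite setUC !mulN1r opprD addrACA subrr addr0.
  by rewrite addrAC.
have step k : f (k + 1) = f k + 1 \/ f (k + 1) = f k - 1.
  have [l e _] := hf k; rewrite ordS5E in e.
  have neq : f k != f (k + 1).
    by rewrite (inj_eq perm_inj) -subr_eq0 opprD addNKr.
  have [[-> ->]|[-> ->]] := edge_pair_cases neq e; first by left.
  by right; rewrite addrK.
have two_neq (x : 'I_5) : x + 1 + 1 != x by rewrite -addrA -subr_eq0 addrAC subrr.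
(* Reversing direction would give [f (k + 1 + 1) = f k], against injectivity. *)
have same_sign k : f (k + 1) = f k + 1 <-> f (k + 1 + 1) = f (k + 1) + 1.
  have fkk : f (k + 1 + 1) != f k by rewrite (inj_eq perm_inj) two_neq.
  split=> e1.
    by have [//|] := step (k + 1); rewrite e1 addrK => e2; rewrite e2 eqxx in fkk.
  by have [//|e2] := step k; rewrite e1 e2 subrK eqxx in fkk.
have iterE (P : 'I_5 -> Prop) :
    P 0 -> (forall k, P k -> P (k + 1)) -> forall k, P k.
  move=> P0 PS k; rewrite -[k]natr_Zp; elim: (val k) => [|n IHn]; first exact: P0.
  by rewrite mulrSr; exact: PS.
have [f1|f1] := step 0.
  have fS : forall k, f (k + 1) = f k + 1 by apply: iterE => // k /same_sign.
  exists (f 0), 1; split=> [|k]; first by left.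
  have -> : f 0 + 1 * k = f k.
    move: k; apply: iterE => [|k fk]; first by rewrite mulr0 addr0.
    by rewrite fS -fk mulrDr mulr1 addrA.
  have [l e <-] := hf k; congr (b (j, _)); move: e; rewrite ordS5E fS.
  have neq : f k != f k + 1 by rewrite -subr_eq0 opprD addNKr.
  by case/(edge_pair_cases neq) => [[//]|[<- /esym/eqP]]; rewrite (negPf (two_neq _)).
have fS : forall k, f (k + 1) = f k - 1.
  apply: iterE => // k fk; have [e|//] := step (k + 1).
  have /eqP := (same_sign k).2 e; rewrite fk eq_sym.
  by have := two_neq (f k - 1); rewrite subrK => /negPf ->.
(* The edges [f k] and [f (k + 1) = f k - 1] enclose the corner named by the latter; at [k = 0] this
   is [f 0 - 1]. *)
exists (f 0 - 1), (-1); split=> [|k]; first by right.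
have -> : f 0 - 1 + -1 * k = f (k + 1).
  move: k; apply: iterE => [|k fk]; first by rewrite mulr0 addr0 fS.
  by rewrite (fS (k + 1)) -fk mulrDr mulr1 addrA.
have [l e <-] := hf k; congr (b (j, _)); move: e; rewrite ordS5E.
have neq : f k != f (k + 1).
  by rewrite (inj_eq perm_inj) -subr_eq0 opprD addNKr.
case/(edge_pair_cases neq) => [[<-]|[<- _]] //; rewrite fS => /eqP.
by have := two_neq (f k - 1); rewrite subrK eq_sym => /negPf ->.
Qed.

Lemma congruent_perm_eq (R : realType) (a b : corner -> R) (i j : tile) :
  congruent a b i j -> perm_eq (tile_angles b j) (tile_angles a i).
Proof.
move=> /congruentP [r [e [he hb]]].
have inj : injective (fun k : 'I_5 => r + e * k).
  by move=> k l /addrI; case: he => ->; rewrite ?mul1r // !mulN1r => /oppr_inj.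
have -> : tile_angles a i = [seq b (j, l) | l <- [seq r + e * k | k <- enum 'I_5]].
  by rewrite -map_comp; apply: eq_map => k /=.
apply: perm_map; apply: uniq_perm; rewrite ?(map_inj_uniq inj) ?enum_uniq //.
move=> k; rewrite mem_enum; apply/esym/mapP.
exists (invF inj k); rewrite ?mem_enum //; exact: esym (f_invF inj k).
Qed.

(** * Transport along pattern symmetries *)

Lemma pattern_symmetryV (s : {perm tile}) :
  pattern_symmetry s -> pattern_symmetry s^-1%g.
Proof.
have sK (e : {set tile}) : s @: (s^-1%g @: e) = e.
  rewrite -imset_comp -[RHS]imset_id; apply: eq_imset => x /=; exact: permKV.
by move=> [hE hV]; split=> e; [rewrite -hE sK | rewrite -hV sK].
Qed.

Lemma carriesV (T : Type) (s : {perm tile}) (a b : corner -> T) :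
  carries s a b -> carries s^-1%g b a.
Proof.
move=> sab c d e1 eV; apply/esym/sab; first by rewrite e1 permKV.
rewrite eV -imset_comp -[LHS]imset_id; apply: eq_imset => x /=.
by rewrite permKV.
Qed.

(** The symmetry only promises that the image triple is a vertex; as it contains [s c.1], some
    corner of that tile sits there. *)
Lemma corner_image (s : {perm tile}) (c : corner) : pattern_symmetry s ->
  exists2 d : corner, d.1 = s c.1 & vertex d = s @: vertex c.
Proof.
move=> [_ hV]; have : is_vertex (s @: vertex c).
  by rewrite hV; apply/existsP; exists c.
case/existsP => d0 /eqP e.
have : s c.1 \in vertex d0 by rewrite -e imset_f // !inE eqxx.
by case/mem_vertex => d d1 dV; exists d; rewrite // dV e.
Qed.

Lemma neighbour_image (s : {perm tile}) (i : tile) (k : 'I_5) :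
  pattern_symmetry s -> exists l, neighbour (s i) l = s (neighbour i k).
Proof.
move=> [hE _]; have : is_edge (s @: edge i k).
  by rewrite hE; apply/existsP; exists i; apply/existsP; exists k.
case/existsP => j /existsP [l /eqP]; rewrite /edge imsetU !imset_set1 => e.
have nneq : s (neighbour i k) != s i by rewrite (inj_eq perm_inj) neighbour_neq.
have : s i \in [set j; neighbour j l] by rewrite -e set21.
have : s (neighbour i k) \in [set j; neighbour j l] by rewrite -e set22.
rewrite !inE => /orP[]/eqP nE /orP[]/eqP iE; move: nneq; rewrite nE iE ?eqxx // => _.
  by have [m] := neighbour_sym j l; exists m.
by exists l.
Qed.

(** A symmetry maps the neighbours of [i] bijectively to those of [s i], which gives the
    correspondence of edges; as it also preserves vertices, adjacent edges stay adjacent. *)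
Lemma carries_congruent (T : Type) (s : {perm tile}) (a b : corner -> T) (i : tile) :
  pattern_symmetry s -> carries s a b -> congruent a b i (s i).
Proof.
move=> sP sab.
have {}/all_sig [f fE] k : {l | neighbour (s i) l = s (neighbour i k)}.
  have : [exists l, neighbour (s i) l == s (neighbour i k)].
    by have [l e] := neighbour_image i k sP; apply/existsP; exists l; apply/eqP.
  by move/existsP/sigW => [l /eqP]; exists l.
have f_inj : injective f.
  by move=> k l e; apply/(@neighbour_inj i)/(@perm_inj _ s); rewrite -!fE e.
exists (perm f_inj) => k; rewrite !permE.
have [[j l] /= -> dV] := corner_image (i, k) sP; exists l; last exact: sab.
(* Since [s i] is not its own neighbour, testing only its neighbours for membership in the two equal
   vertices leaves an equality of edge pairs. *)
apply/setP => m; have /setP/(_ (neighbour (s i) m)) := dV.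
rewrite /vertex /= !imsetU !imset_set1 -!fE !inE (negPf (neighbour_neq _ _)) /=.
by rewrite !(inj_eq (@neighbour_inj (s i))).
Qed.

(** The symmetry induces an injective, hence bijective, map of the corners, along which a vertex sum
    of [b] becomes the sum of [a] at the preimage. *)
Lemma carries_vertex_sums (R : realType) (s : {perm tile}) (a b : corner -> R) :
  pattern_symmetry s -> carries s a b -> vertex_sums a -> vertex_sums b.
Proof.
move=> sP sab aV.
have {}/all_sig [f fE] c : {d : corner | d.1 = s c.1 /\ vertex d = s @: vertex c}.
  have : [exists d : corner, (d.1 == s c.1) && (vertex d == s @: vertex c)].
    have [d e1 eV] := corner_image c sP; apply/existsP; exists d.
    by rewrite e1 eV !eqxx.
  by move/existsP/sigW => [d /andP [/eqP e1 /eqP eV]]; exists d.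
have f_inj : injective f.
  move=> c d e; have [[c1 cV] [d1 dV]] := (fE c, fE d).
  apply: corner_inj; first by apply: (@perm_inj _ s); rewrite -c1 -d1 e.
  by apply: (imset_inj (@perm_inj _ s)); rewrite -cV -dV e.
move=> v; have [_ hV] := sP.
have -> : v = s @: (s^-1%g @: v).
  rewrite -imset_comp -[LHS]imset_id; apply: eq_imset => x /=; by rewrite permKV.
rewrite hV => /aV <-; rewrite (reindex_inj f_inj); apply: eq_big => [c|c _].
  by rewrite (fE c).2 (inj_eq (imset_inj (@perm_inj _ s))).
by have [c1 cV] := fE c; rewrite (sab c).
Qed.

Lemma carries_tiling (R : realType) (w : seq R) (s : {perm tile})
    (a b : corner -> R) :
  pattern_symmetry s -> carries s a b ->
  tiling_with_angles w a -> tiling_with_angles w b.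
Proof.
move=> sP sab [[aV aC] aw].
have sVP := pattern_symmetryV sP; have sba := carriesV sab.
split; [split | move=> i]; first exact: carries_vertex_sums sab aV.
  move=> i j; apply: congruent_trans (carries_congruent i sVP sba) _.
  rewrite -[j](permKV s).
  exact: congruent_trans (aC _ _) (carries_congruent _ sP sab).
apply: perm_trans (aw (s^-1%g i)); rewrite -{1}[i](permKV s).
exact: congruent_perm_eq (carries_congruent _ sP sab).
Qed.

(** * Tables of letters *)

Definition letter_eqb (x y : letter) : bool :=
  match x, y with
  | Alpha, Alpha | Beta, Beta | Gamma, Gamma => true
  | _, _ => false
  end.

Lemma letter_eqbP : Equality.axiom letter_eqb.
Proof. by case; case; constructor. Qed.

HB.instance Definition _ := hasDecEq.Build letter letter_eqbP.

Section LetterTables.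
Local Open Scope nat_scope.

(** The vertex types $\alpha^3$ and $\beta^2\gamma$, in any order; [balancedP] shows that no others
    occur. *)
Definition balanced (x y z : letter) : bool :=
  match x, y, z with
  | Alpha, Alpha, Alpha
  | Beta, Beta, Gamma | Beta, Gamma, Beta | Gamma, Beta, Beta => true
  | _, _, _ => false
  end.

Definition lookup (T : seq (seq letter)) (c : nat * nat) : letter :=
  nth Alpha (nth [::] T c.1) c.2.

Definition word (X : Type) (t : nat * nat -> X) (i : nat) : seq X :=
  mkseq (fun k => t (i, k)) 5.

Definition table (X : Type) (n : nat) (t : nat * nat -> X) : seq (seq X) :=
  mkseq (word t) n.

(** Reads [w] from position [re.1] in steps of [re.2] modulo 5: the map [r + e * k] of [congruentP]
    on words. *)
Definition dihedral (w : seq letter) (re : nat * nat) : seq letter :=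
  mkseq (fun k => nth Alpha w ((re.1 + re.2 * k) %% 5)) 5.

(* [4] stands for [-1] modulo [5]. *)
Definition dihedral_orbit (w : seq letter) : seq (seq letter) :=
  undup [seq dihedral w (r, e) | e <- [:: 1; 4], r <- iota 0 5].

(** * Exhaustive search, tile by tile *)

Definition corners_at (c : nat * nat) : seq (nat * nat) :=
  [:: c; next_nat c; next_nat (next_nat c)].

Definition balanced_at (t : nat * nat -> letter) (cs : seq (nat * nat)) : bool :=
  if [seq t c | c <- cs] is [:: x; y; z] then balanced x y z else false.

(** These are the vertices completed by placing tile [n], so each vertex is tested once and as early
    as possible. *)
Definition completed_vertices (n : nat) : seq (seq (nat * nat)) :=
  [seq cs <- [seq corners_at (n, k) | k <- iota 0 5] | all (fun c => c.1 <= n) cs].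

Definition add_tile (W : seq (seq letter)) (n : nat)
    (L : seq (seq (seq letter))) : seq (seq (seq letter)) :=
  let V := completed_vertices n in
  flatten [seq [seq T <- [seq rcons p w | w <- W] | all (balanced_at (lookup T)) V]
             | p <- L].

Definition search (W : seq (seq letter)) (n : nat) : seq (seq (seq letter)) :=
  iteri n (add_tile W) [:: [::]].

Lemma lookup_table (n : nat) (t : nat * nat -> letter) (c : nat * nat) :
  c.1 < n -> c.2 < 5 -> lookup (table n t) c = t c.
Proof.
by case: c => i k /= i_lt k_lt; rewrite /lookup /table nth_mkseq //= nth_mkseq.
Qed.

(** A completed vertex involves only tiles already placed, so the truncated table agrees with [t]
    there and passes every test. *)
Lemma search_complete (W : seq (seq letter)) (t : nat * nat -> letter) (n : nat) :
  (forall i, i < n -> word t i \in W) ->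
  (forall i k, i < n -> k < 5 -> balanced_at t (corners_at (i, k))) ->
  table n t \in search W n.
Proof.
elim: n => // n IHn tW tV.
apply/flatten_mapP; exists (table n t).
  apply: IHn => [i i_lt|i k i_lt]; first by apply/tW/ltnW.
  by apply/tV/ltnW.
rewrite mem_filter /table mkseqS map_f ?tW // andbT; apply/allP => cs.
rewrite mem_filter => /andP [lt_n /mapP [k]].
rewrite mem_iota /= => k_lt csE; rewrite {cs}csE in lt_n *.
rewrite -mkseqS -/(table _ _); have := tV n k (leqnn _) k_lt.
case/and4P: lt_n => _ lt1 lt2 _.
by rewrite /balanced_at /= !lookup_table ?ltn_mod.
Qed.

(** * The cyclic words on $\alpha^2\beta^2\gamma$ *)

Definition angle_letters : seq letter := [:: Alpha; Alpha; Beta; Beta; Gamma].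

(** After $\gamma$ come two $\alpha$ and two $\beta$ in one of six orders; reflection fixes two of
    these and pairs up the other four, which leaves four classes. *)
Definition word_classes : seq (seq (seq letter)) :=
  [seq dihedral_orbit w
     | w <- [:: [:: Gamma; Alpha; Beta; Alpha; Beta];
                [:: Gamma; Alpha; Beta; Beta; Alpha];
                [:: Gamma; Alpha; Alpha; Beta; Beta];
                [:: Gamma; Beta; Alpha; Alpha; Beta]]].

Lemma word_class (w : seq letter) : perm_eq w angle_letters ->
  exists2 W, W \in word_classes & {subset dihedral_orbit w <= W}.
Proof.
rewrite -mem_permutations => wP.
have : all (fun w => has (fun W => all (mem W) (dihedral_orbit w)) word_classes)
  (permutations angle_letters) by vm_compute.
by move=> /allP/(_ w wP)/hasP [W WP /allP sub]; exists W.
Qed.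

(** * The listed tilings *)

(** The table is extracted from [tilingI] itself, so that the two agree by conversion. *)
Definition tableI : seq (seq letter) :=
  ltac:(let t := eval cbv [tilingI] in tilingI in
        match t with of_table ?T => exact T end).

Definition tableII : seq (seq letter) :=
  ltac:(let t := eval cbv [tilingII] in tilingII in
        match t with of_table ?T => exact T end).

(** Numbered from 0: the pair [(0, 4)] stands for $E_{1,5}$. *)
Definition exchangeable_pairs : seq (nat * nat) :=
  [:: (0, 4); (1, 2); (3, 7); (5, 10); (6, 11); (8, 9)].

Definition around_pair (p c : nat * nat) : bool :=
  (c.1 \in [:: p.1; p.2]) && all (mem (vertex_tiles c)) [:: p.1; p.2].

Definition exchange_nat (ps : seq (nat * nat)) (c : nat * nat) : letter :=
  let x := lookup tableII c in
  if has (around_pair^~ c) ps then swap_beta_gamma x else x.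

Fixpoint subsequences (X : Type) (s : seq X) : seq (seq X) :=
  if s is x :: s' then
    let ss := subsequences s' in [seq x :: u | u <- ss] ++ ss
  else [:: [::]].

Definition listed_tables : seq (seq (seq letter)) :=
  tableI :: [seq table 12 (exchange_nat ps)
               | ps <- subsequences exchangeable_pairs].

(* The rotation by one fifth of a turn about [P_1]. *)
Definition rotation (i : nat) : nat :=
  nth 0 [:: 0; 2; 3; 4; 5; 1; 7; 8; 9; 10; 6; 11] i.

(** The image of a corner is located by its tile and its vertex. *)
Definition rotated_corner (r : nat) (c : nat * nat) : nat * nat :=
  let s := iter r rotation in
  let v := [seq s j | j <- vertex_tiles c] in
  (s c.1, find (fun k => same_elements (vertex_tiles (s c.1, k)) v) (iota 0 5)).

Definition rotated_corners : seq (seq (seq (nat * nat))) :=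
  [seq table 12 (rotated_corner r) | r <- iota 0 5].

Definition pull_back (C : seq (seq (nat * nat))) (T : seq (seq letter)) :
    seq (seq letter) :=
  [seq [seq lookup T c | c <- cs] | cs <- C].

(** The classification proper, by evaluation. The listed tables use only the first two of the four
    words, so the search finds nothing for the other two. *)
Lemma search_listed :
  all (fun W => all (fun T => has (fun C => pull_back C T \in listed_tables)
    rotated_corners) (search W 12)) word_classes.
Proof. by vm_compute. Qed.

(** For the converse: the three conditions in the form that [tiling_with_lettersP] asks for. *)
Lemma listed_tables_tilings :
  all (fun T => let w := word (lookup T) in
    [&& all (fun c => balanced_at (lookup T) (corners_at c)) nat_corners,
        all (fun i => perm_eq (w i) angle_letters) (iota 0 12)
      & all (fun j => let W := dihedral_orbit (w j) in
                      all (fun i => w i \in W) (iota 0 12)) (iota 0 12)])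
    listed_tables.
Proof. by vm_compute. Qed.

Lemma rotated_corners_correct :
  all (fun r => let s := iter r rotation in
    all (fun c => all (fun k =>
      same_elements (vertex_tiles (s c.1, k)) [seq s j | j <- vertex_tiles c]
        ==> ((s c.1, k) == rotated_corner r c)) (iota 0 5)) nat_corners)
    (iota 0 5).
Proof. by vm_compute. Qed.

Lemma filter_subsequences (X : eqType) (p : pred X) (s : seq X) :
  filter p s \in subsequences s.
Proof.
elim: s => //= x s IHs; rewrite mem_cat; case: (p x); rewrite ?IHs ?orbT //.
by rewrite map_f.
Qed.

Lemma subsequencesS (X : eqType) (s u : seq X) :
  u \in subsequences s -> {subset u <= s}.
Proof.
elim: s u => [|x s IHs] u /=; first by rewrite inE => /eqP ->.
rewrite mem_cat => /orP [/mapP [v /IHs vs ->] | /IHs us] y; rewrite !inE.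
  by case/orP => [-> // | /vs ->]; rewrite orbT.
by move=> /us ->; rewrite orbT.
Qed.

Definition pair_tiles (p : nat * nat) : {set tile} := tiles_of [:: p.1; p.2].

Lemma exchangeable_edgesE :
  exchangeable_edges = [set e in [seq pair_tiles p | p <- exchangeable_pairs]].
Proof.
have pairE (i j : nat) : i.-1 < 12 -> j.-1 < 12 ->
    [set Ptile i; Ptile j] = pair_tiles (i.-1, j.-1).
  by move=> i12 j12; apply/setP => x; rewrite !inE -!val_eqE /= !modn_small.
by apply/setP => e; rewrite !inE !pairE // !orbA.
Qed.

Lemma exchange_natE (ps : seq (nat * nat)) (c : corner) :
  {subset ps <= exchangeable_pairs} ->
  exchange [set e in [seq pair_tiles p | p <- ps]] tilingII c
    = exchange_nat ps (nat_corner c).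
Proof.
move=> ps_sub.
have aroundE p : p \in ps -> around (pair_tiles p) c = around_pair p (nat_corner c).
  move=> /ps_sub p_exch; rewrite /around /around_pair vertexE tiles_of_sub.
    by rewrite !inE.
  by move: p p_exch; apply/allP.
rewrite /exchange /exchange_nat; congr (if _ then _ else _).
apply/existsP/hasP => [[e /andP [] ] | [p p_ps p_c]].
  rewrite inE => /mapP [p p_ps ->]; rewrite aroundE // => p_c.
  by exists p.
by exists (pair_tiles p); rewrite inE map_f //= aroundE.
Qed.

Lemma listed_table (t : corner -> letter) : listed t ->
  exists2 T, T \in listed_tables & forall c, t c = lookup T (nat_corner c).
Proof.
case=> [-> | [S S_sub ->]]; first by exists tableI; rewrite // inE eqxx.
(* Listing the members of [S] in the order of [exchangeable_pairs] makes it one of the enumerated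
   subsequences. *)
pose ps := [seq p <- exchangeable_pairs | pair_tiles p \in S].
have SE : S = [set e in [seq pair_tiles p | p <- ps]].
  apply/setP => e; rewrite inE; apply/idP/mapP => [eS | [p]]; last first.
    by rewrite mem_filter => /andP [pS _] ->.
  have := subsetP S_sub e eS; rewrite exchangeable_edgesE inE => /mapP [p pE eE].
  by exists p; rewrite // mem_filter -eE eS.
exists (table 12 (exchange_nat ps)).
  rewrite inE; apply/orP; right; apply/mapP; exists ps => //.
  exact: filter_subsequences.
move=> c; rewrite lookup_table ?ltn_ord // {1}SE exchange_natE // => p.
by rewrite mem_filter => /andP [].
Qed.

Lemma table_listed (T : seq (seq letter)) : T \in listed_tables ->
  exists2 t, listed t & forall c, t c = lookup T (nat_corner c).
Proof.
rewrite inE => /orP [/eqP -> | /mapP [ps /subsequencesS ps_sub ->]].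
  by exists tilingI; first left.
exists (exchange [set e in [seq pair_tiles p | p <- ps]] tilingII).
  right; exists [set e in [seq pair_tiles p | p <- ps]] => //.
  apply/subsetP => e; rewrite exchangeable_edgesE !in_set => /mapP [p p_ps ->].
  by apply/mapP; exists p => //; exact: ps_sub.
by move=> c; rewrite lookup_table ?ltn_ord // exchange_natE.
Qed.

(** * Rotations about $P_1$ as pattern symmetries *)

(** An injective map of a finite set into itself is onto, so it is enough to check that edges go to
    edges and vertices to vertices. *)
Lemma stable_imset (X : finType) (s : {perm X}) (P : pred {set X}) :
  (forall e : {set X}, P e -> P (s @: e)) ->
  forall e : {set X}, P (s @: e) = P e.
Proof.
move=> sP e; have s_inj := imset_inj (@perm_inj _ s).
have imE : [set s @: (x : {set X}) | x in [set x | P x]] = [set x | P x].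
  apply/eqP; rewrite eqEcard card_imset // leqnn andbT.
  by apply/subsetP => _ /imsetP [x xP ->]; rewrite !in_set in xP *; exact: sP.
apply/idP/idP => [|/sP //].
have -> : P (s @: e) = (s @: e \in [set x | P x]) by rewrite in_set.
by rewrite -imE mem_imset // in_set.
Qed.

Definition nat_symmetry (s : nat -> nat) : bool :=
  [&& all (fun i => s i < 12) (iota 0 12),
      all (fun i => all (fun j => (s i == s j) ==> (i == j)) (iota 0 12))
        (iota 0 12)
    & all (fun c =>
        has (fun k => same_elements [seq s j | j <- edge_tiles c]
                        (edge_tiles (s c.1, k))) (iota 0 5) &&
        has (fun k => same_elements [seq s j | j <- vertex_tiles c]
                        (vertex_tiles (s c.1, k))) (iota 0 5)) nat_corners].

Lemma rotation_nat_symmetry :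
  all (fun r => nat_symmetry (iter r rotation)) (iota 0 5).
Proof. by vm_compute. Qed.

Lemma imset_tiles_of (s : {perm tile}) (f : nat -> nat) (v : seq nat) :
  (forall i, val (s i) = f (val i)) -> all (gtn 12) v ->
  s @: tiles_of v = tiles_of [seq f j | j <- v].
Proof.
move=> sE /allP v12; apply/setP => x; rewrite inE; apply/imsetP/mapP => [[i]|[j]].
  by rewrite inE => iv ->; exists (val i); rewrite ?sE.
move=> jv xE; exists (Ordinal (v12 j jv)); first by rewrite inE.
by apply: val_inj; rewrite sE.
Qed.

Lemma nat_symmetryP (f : nat -> nat) : nat_symmetry f ->
  exists2 s : {perm tile}, pattern_symmetry s & forall i, val (s i) = f (val i).
Proof.
case/and3P => f12 f_inj f_pattern.
have fE (i : tile) : val (inord (f i) : tile) = f i.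
  by rewrite /= inordK // (@all_tiles (fun i => f i < 12)).
have inj : injective (fun i : tile => inord (f i) : tile).
  move=> i j /(congr1 val); rewrite !fE => /eqP e; apply/val_inj/eqP.
  apply: implyP e.
  by have /allP := all_tiles i f_inj; apply; rewrite mem_iota /= ltn_ord.
have sE i : val (perm inj i) = f (val i) by rewrite permE fE.
have f_lt (v : seq nat) : all (gtn 12) v -> all (gtn 12) [seq f j | j <- v].
  move=> /allP v12; apply/allP => _ /mapP [j /v12 j12 ->] /=.
  by rewrite -[j]/(val (Ordinal j12)) -sE ltn_ord.
exists (perm inj); last exact: sE.
split; apply: stable_imset => e.
  case/existsP => i /existsP [k /eqP ->]; apply/existsP; exists (perm inj i).
  have /andP [/hasP [l l5 e_same] _] := all_nat_corners (i, k) f_pattern.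
  rewrite mem_iota /= in l5; apply/existsP; exists (Ordinal l5).
  rewrite !edgeE (imset_tiles_of sE) ?edge_tiles_lt //.
  rewrite tiles_of_eq ?edge_tiles_lt ?f_lt ?edge_tiles_lt //.
  by rewrite /nat_corner /= sE.
case/existsP => c /eqP ->; apply/existsP.
have /andP [_ /hasP [l l5 v_same]] := all_nat_corners c f_pattern.
rewrite mem_iota /= in l5; exists (perm inj c.1, Ordinal l5).
rewrite !vertexE (imset_tiles_of sE) ?vertex_tiles_lt //.
rewrite tiles_of_eq ?vertex_tiles_lt ?f_lt ?vertex_tiles_lt //.
by rewrite {2}/nat_corner /= sE.
Qed.

(** The pull-back at [c] is [t] at the image of [c], so the rotation carries the pulled-back pattern
    to [t]. *)
Lemma pull_back_rotation (t : corner -> letter) (T : seq (seq letter)) (r : nat) :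
  (r < 5)%N -> (forall c, t c = lookup T (nat_corner c)) ->
  exists2 s : {perm tile}, pattern_symmetry s &
    forall c d : corner, d.1 = s c.1 -> vertex d = s @: vertex c ->
      t d = lookup (pull_back (table 12 (rotated_corner r)) T) (nat_corner c).
Proof.
move=> r5 tE; have r_iota : r \in iota 0 5 by rewrite mem_iota.
have [s sP sE] := nat_symmetryP (allP rotation_nat_symmetry r r_iota).
exists s => // c d d1 dV; rewrite tE.
have -> : nat_corner d = rotated_corner r (nat_corner c).
  have cE := all_nat_corners c (allP rotated_corners_correct r r_iota).
  have -> : nat_corner d = (iter r rotation (nat_corner c).1, val d.2).
    by rewrite /nat_corner d1 sE.
  have d2 : val d.2 \in iota 0 5 by rewrite mem_iota /= ltn_ord.
  apply/eqP; apply: implyP (allP cE _ d2) _; rewrite -sE -d1.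
  have f_lt : all (gtn 12) [seq iter r rotation j | j <- vertex_tiles (nat_corner c)].
    apply/allP => _ /mapP [j /(allP (vertex_tiles_lt c)) j12 ->].
    by rewrite /= -[j]/(val (Ordinal j12)) -sE ltn_ord.
  move/eqP: dV; rewrite !vertexE (imset_tiles_of sE) ?vertex_tiles_lt //.
  by rewrite tiles_of_eq ?vertex_tiles_lt.
rewrite {2}/lookup (nth_map [::]) ?size_mkseq ?ltn_ord // nth_mkseq ?ltn_ord //.
by rewrite (nth_map (0, 0)) ?size_mkseq ?ltn_ord // nth_mkseq ?ltn_ord.
Qed.

End LetterTables.

(** * From angles to letters *)

Lemma letter_value_inj (T : Type) (alpha beta gamma : T) :
  alpha <> beta -> alpha <> gamma -> beta <> gamma ->
  injective (letter_value alpha beta gamma).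
Proof. by move=> ab ac bc [] [] /=; congruence. Qed.

(** Since $3\alpha=2\beta+\gamma=2\pi$, any other triple with sum $2\pi$ would make two of the
    angles equal, by linear arithmetic. *)
Lemma balancedP (R : realType) (alpha beta gamma : R) (x y z : letter) :
  alpha = 2 * pi / 3 -> 2 * beta + gamma = 2 * pi ->
  alpha <> beta -> alpha <> gamma -> beta <> gamma ->
  let f := letter_value alpha beta gamma in
  f x + f y + f z = 2 * pi <-> balanced x y z.
Proof.
move=> aE sE ab ac bc /=; case: x; case: y; case: z => /=;
  (split=> // e; first
    [ exfalso; first [apply: ab; lra | apply: ac; lra | apply: bc; lra] | lra ]).
Qed.

(** The pairs [(r, e)] that index the orbit are the parameters of [congruentP], with 4 read as -1;
    injectivity of [f] lets letters replace angles. *)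
Lemma congruent_tiles_orbit (R : realType) (f : letter -> R)
    (t : corner -> letter) (u : nat * nat -> letter) (i j : tile) :
  injective f -> (forall c, t c = u (nat_corner c)) ->
  congruent (f \o t) (f \o t) i j <-> word u i \in dihedral_orbit (word u j).
Proof.
move=> f_inj tE; rewrite congruentP mem_undup.
have posE (r e k : 'I_5) : val (r + e * k) = ((r + e * k) %% 5)%N.
  by rewrite /= modnDmr.
split=> [[r [e [e1 h]]] | /allpairsP [[e r] [e1 r5 /eqP wE]]].
  apply/allpairsP; exists (val e, val r); split.
  - by case: e1 => ->.
  - by rewrite mem_iota ltn_ord.
  apply/eq_in_map => k; rewrite mem_iota /= => k5.
  have /f_inj := h (Ordinal k5); rewrite !tE /nat_corner posE /= => <-.
  by rewrite nth_mkseq // ltn_mod.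
rewrite mem_iota in r5; move: e1 r5 wE => /= e1 r5 wE.
have e5 : (e < 5)%N by move: e1; rewrite !inE => /orP [] /eqP ->.
exists (Ordinal r5), (Ordinal e5); split.
  by move: e1; rewrite !inE => /orP [] /eqP e1; [left | right]; apply: val_inj.
move=> k /=; rewrite !tE /nat_corner posE /=; congr f; apply/esym.
have := congr1 (fun w => nth Alpha w k) (eqP wE).
by rewrite !nth_mkseq ?ltn_ord ?ltn_mod.
Qed.

Lemma tile_anglesE (R : realType) (f : letter -> R) (t : corner -> letter)
    (u : nat * nat -> letter) (i : tile) :
  (forall c, t c = u (nat_corner c)) ->
  tile_angles (f \o t) i = map f (word u i).
Proof.
move=> tE; rewrite /tile_angles /word /mkseq -val_enum_ord -!map_comp.
by apply: eq_map => k /=; rewrite tE.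
Qed.

Lemma tiling_with_lettersP (R : realType) (alpha beta gamma : R)
    (t : corner -> letter) (u : nat * nat -> letter) :
  alpha = 2 * pi / 3 -> 2 * beta + gamma = 2 * pi ->
  alpha <> beta -> alpha <> gamma -> beta <> gamma ->
  (forall c, t c = u (nat_corner c)) ->
  tiling_with_angles [:: alpha; alpha; beta; beta; gamma]
    (letter_value alpha beta gamma \o t) <->
  [/\ forall c : corner, balanced_at u (corners_at (nat_corner c)),
      forall i : tile, perm_eq (word u i) angle_letters
    & forall i j : tile, word u i \in dihedral_orbit (word u j)].
Proof.
move=> aE sE ab ac bc tE; pose f := letter_value alpha beta gamma.
have f_inj : injective f := letter_value_inj ab ac bc.
have balE c :
    f (t c) + f (t (next_corner c)) + f (t (next_corner (next_corner c))) = 2 * pi <->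
    balanced_at u (corners_at (nat_corner c)).
  by rewrite balancedP // !tE !nat_corner_next.
have permE i : perm_eq (tile_angles (f \o t) i) [:: alpha; alpha; beta; beta; gamma]
    = perm_eq (word u i) angle_letters.
  rewrite (tile_anglesE _ _ tE); apply/idP/idP; last exact: perm_map.
  exact: (@perm_map_inj _ _ f f_inj _ angle_letters).
split=> [[[/vertex_sumsP tV tC] tw] | [tV tw tC]].
  split=> [c|i|i j]; first exact/balE/tV.
    by rewrite -permE.
  by apply/(congruent_tiles_orbit _ _ f_inj tE)/tC.
split; [split | by move=> i; rewrite permE].
  by apply/vertex_sumsP => c; apply/balE.
by move=> i j; apply/(congruent_tiles_orbit _ _ f_inj tE).
Qed.

(** Double counting: adding up the vertex sum at each of the 60 corners gives $60\cdot 2\pi$ and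
    counts every angle three times, while the angles of the twelve tiles add up to $12\sum w$. *)
Lemma tiling_angle_sum (R : realType) (w : seq R) (a : corner -> R) :
  tiling_with_angles w a -> (3 * \sum_(x <- w) x) = 10 * pi.
Proof.
move=> [[/vertex_sumsP aV _] aw].
have sumE : \sum_c a c = 12 * \sum_(x <- w) x.
  rewrite (eq_bigr (fun c => a (c.1, c.2))) => [|[i k]] //.
  rewrite -(pair_bigA _ (fun i k => a (i, k))) /=.
  rewrite (eq_bigr (fun _ => \sum_(x <- w) x)) => [|i _].
    by rewrite sumr_const card_ord mulr_natl.
  by rewrite -(perm_big _ (aw i)) /tile_angles big_map big_enum.
have next_sum (g : corner -> R) : \sum_c g (next_corner c) = \sum_c g c.
  by rewrite [RHS](reindex_inj next_corner_inj).
have : \sum_c (a c + a (next_corner c) + a (next_corner (next_corner c))) =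
    60 * (2 * pi).
  rewrite (eq_bigr (fun _ => 2 * pi)) => [|c _]; last exact: aV.
  have card60 : #|{: corner}| = 60%N by rewrite card_prod !card_ord.
  by rewrite sumr_const [#|_|]card60 [RHS]mulr_natl.
rewrite !big_split /= (next_sum (fun c => a (next_corner c))) !next_sum sumE => e.
lra.
Qed.

Theorem proposition18 (R : realType) (alpha beta gamma : R)
    (halpha : alpha = 2 * pi / 3)
    (hab : alpha <> beta) (hac : alpha <> gamma) (hbc : beta <> gamma)
    (a : corner -> R) :
  tiling_with_angles [:: alpha; alpha; beta; beta; gamma] a <->
  2 * beta + gamma = 2 * pi /\
  exists2 t : corner -> letter, listed t &
    same_up_to_symmetry (letter_value alpha beta gamma \o t) a.
Proof.
pose f := letter_value alpha beta gamma; set w := [:: _; _; _; _; _].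
split=> [aT | [sE [t /listed_table [T TL tE] [s sP sab]]]]; last first.
  (* Being a tiling is invariant under symmetries, and every listed table passed the finite
     check. *)
  apply: (carries_tiling sP sab).
  apply/(@tiling_with_lettersP _ _ _ _ _ (lookup T)) => //.
  have /and3P [tV tw tC] := allP listed_tables_tilings T TL.
  split=> [c|i|i j]; first exact: (all_nat_corners c tV).
    exact: (all_tiles i tw).
  exact: (all_tiles i (all_tiles j tC)).
(* With $\alpha=2\pi/3$, the total $3(2\alpha+2\beta+\gamma)=10\pi$ leaves this relation. *)
have sE : 2 * beta + gamma = 2 * pi.
  by have := tiling_angle_sum aT; rewrite !big_cons big_nil; lra.
split=> //; have f_inj : injective f := letter_value_inj hab hac hbc.
(* Every angle occurs in [w], so the default [Gamma] is reached only at the value [gamma]. *)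
pose t c := if a c == alpha then Alpha else if a c == beta then Beta else Gamma.
have aE : a = f \o t.
  apply/boolp.funext => -[i k] /=; have : a (i, k) \in w.
    by rewrite -(perm_mem (aT.2 i)) map_f ?mem_enum.
  rewrite /t !inE; case: eqP => [-> //|_]; case: eqP => [-> //|_].
  by move=> /= /eqP.
pose u (c : nat * nat) := t (inord c.1, inord c.2).
have tE c : t c = u (nat_corner c).
  by case: c => i k; rewrite /u /= !inord_val.
move: aT; rewrite aE => /(tiling_with_lettersP halpha sE hab hac hbc tE) [tV tw tC].
(* All words lie in the dihedral orbit of the word of $P_1$, so one class serves for all tiles. *)
have [W WP W_sub] := word_class (tw ord0).
have : table 12 u \in search W 12.
  apply: search_complete => [i i12|i k i12 k5].
    by apply: W_sub; exact: (tC (Ordinal i12) ord0).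
  exact: (tV (Ordinal i12, Ordinal k5)).
move=> /(allP (allP search_listed W WP)) /hasP [C /mapP [r]].
rewrite mem_iota /= => r5 -> /table_listed [t0 t0L t0E].
have tTE c : t c = lookup (table 12 u) (nat_corner c).
  by rewrite lookup_table ?ltn_ord // tE.
(* The listed tiling [t0] is the pull-back of [t], so the rotation carries [t0] to [t]. *)
have [s sP sE'] := pull_back_rotation r5 tTE.
exists t0 => //; exists s => // c d d1 dV.
by rewrite /= (sE' c d d1 dV) t0E.
Qed.
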